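(* Let $d\geq 2$ be an integer and $0<\epsilon\leq 1$ a real number. For every deterministic online coloring algorithm $\mathcal{A}$ having a reordering buffer of size $b$ and every integer $n$ with $b\leq n^{1-\epsilon}$ and $n\geq\max\{2d^2,\ 2^{7/\epsilon}\}$, there exists an $n$-vertex chordal graph $G$ with $\chi(G)=d$ (presented adaptively by an adversary) such that the number of colors used by $\mathcal{A}$ is $\Omega(\epsilon\cdot d\cdot\log n)$, with an absolute implicit constant.
   Context: Online graph coloring with a reordering buffer of size $b$: the vertices $v_1,\dots,v_n$ arrive one at a time in an order chosen by an adversary; when $v_t$ arrives, its edges to previously presented vertices are revealed. The algorithm may store vertices temporarily in a buffer and color them later, with the requirement that at the end of step $t$ at least $t-b$ vertices have been colored; each color assignment is irrevocable and must differ from the colors of the already-colored neighbors. The cost is the number of distinct colors used. A graph is chordal if every induced cycle on four or more vertices has a chord. Logarithms are base 2. *)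

(* Defs.v *)
From mathcomp Require Import all_boot all_order all_algebra.
From mathcomp Require Import all_reals all_analysis.

Set Implicit Arguments.
Unset Strict Implicit.
Unset Printing Implicit Defensive.

Import Order.TTheory GRing.Theory Num.Theory.

Definition is_simple n (E : {set 'I_n * 'I_n}) : bool :=
  [forall x, (x, x) \notin E] &&
  [forall x, forall y, ((x, y) \in E) == ((y, x) \in E)].

(* Finite simple graphs on the vertex set {0, ..., n-1}.  Vertices are named
   by order of arrival: vertex i is the one presented at step i+1. *)
Definition sgraph (n : nat) := {E : {set 'I_n * 'I_n} | is_simple E}.

Definition adj n (G : sgraph n) : rel 'I_n := fun x y => (x, y) \in val G.

Definition chordal n (G : sgraph n) : Prop :=
  forall c : seq 'I_n, ucycle (adj G) c -> 3 < size c ->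
  exists x y : 'I_n,
    [/\ x \in c, y \in c, adj G x y, y != next c x & y != prev c x].

Definition proper_coloring n (G : sgraph n) (C : eqType) (f : 'I_n -> C) : bool :=
  [forall x, forall y, adj G x y ==> (f x != f y)].

Definition colorable n (G : sgraph n) (k : nat) : bool :=
  [exists f : {ffun 'I_n -> 'I_k}, proper_coloring G f].

Lemma colorable_ex n (G : sgraph n) : exists k, colorable G k.
Proof.
exists n; apply/existsP; exists [ffun x => x].
apply/forallP => x; apply/forallP => y; apply/implyP; rewrite !ffunE.
apply: contraTneq => ->; rewrite /adj.
by case/andP: (valP G) => /forallP.
Qed.

Definition chi n (G : sgraph n) : nat := ex_minn (colorable_ex G).

Definition past_edges t (E : {set 'I_t.+1 * 'I_t.+1}) : {set 'I_t * 'I_t} :=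
  [set p | (widen_ord (leqnSn t) p.1, widen_ord (leqnSn t) p.2) \in E].

Lemma past_simple t (G : sgraph t.+1) : is_simple (past_edges (val G)).
Proof.
case/andP: (valP G) => /forallP irr /forallP sym; apply/andP; split.
  by apply/forallP => x; rewrite inE /=.
apply/forallP => x; apply/forallP => y; rewrite !inE /=.
by move/forallP: (sym (widen_ord (leqnSn t) x)).
Qed.

(* The subgraph induced by all vertices but the most recent one. *)
Definition past t (G : sgraph t.+1) : sgraph t :=
  exist _ (past_edges (val G)) (past_simple G).

(* [run A G] is the partial coloring at the end of step t, where G is the graph
   revealed so far; uncolored vertices ([None]) are those in the buffer.  It is
   a function of G only, so A is deterministic and online; A is arbitrary, so
   it may be tailored to a given length n of the input.
   [final A G] is the total coloring output if the input ends with G, when the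
   vertices still in the buffer have to be colored as well. *)
Record online_alg (b : nat) := OnlineAlg {
  run : forall t, sgraph t -> 'I_t -> option nat;
  final : forall t, sgraph t -> 'I_t -> nat;
  run_irrevocable : forall t (G : sgraph t.+1) (v : 'I_t) (c : nat),
    run (past G) v = Some c -> run G (widen_ord (leqnSn t) v) = Some c;
  run_proper : forall t (G : sgraph t) (x y : 'I_t) (c : nat),
    adj G x y -> run G x = Some c -> run G y <> Some c;
  run_buffer : forall t (G : sgraph t), t - b <= #|[set v | run G v]|;
  final_irrevocable : forall t (G : sgraph t) (v : 'I_t) (c : nat),
    run G v = Some c -> final G v = c;
  final_proper : forall t (G : sgraph t), proper_coloring G (final G)
}.

Definition colors_used b (A : online_alg b) n (G : sgraph n) : nat :=
  size (undup (codom (final A G))).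

Definition log2 (R : realType) (x : R) : R := (ln x / ln 2)%R.

(* Main.v *)
Require Import Defs.
From mathcomp Require Import all_boot all_order all_algebra.
From mathcomp Require Import all_reals all_analysis.
From mathcomp Require Import zify ring lra.

Set Implicit Arguments.
Unset Strict Implicit.
Unset Printing Implicit Defensive.

(* The adversary presents cliques ("blocks") of q = d/2 vertices, organised as a
   forest in which every block is completely joined to its parent.  Such a graph
   is chordal (a vertex of a cycle lying in a lowest block has adjacent
   neighbours) and 2q-colorable (by the parity of the depth).
   Consider two disjoint families of root blocks, each showing k colours.  Either
   their union shows g more colours, with g about q/4, or the colour sets nearly
   coincide.  In that case a new block is joined to all of the second family: it
   avoids the colours of that family, so it contributes at least g colours that
   are missing in the first family as soon as r = q/2 of its vertices are
   coloured.
   Starting from about n/d single blocks, each round of pairing halves the number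
   of families and gains g colours.  The buffer can spoil at most 2b/q families
   per round, since q/2 buffered vertices are needed for each.  So there are about
   log (n/b) rounds or, without spoiled families, log (n/d) >= (log n)/2 rounds.
   A final clique on d vertices makes the chromatic number exactly d. *)

(** * Graphs from relations on the naturals; chordality and chromatic number *)

Definition edges_of n (e : rel nat) : {set 'I_n * 'I_n} :=
  [set z : 'I_n * 'I_n | (z.1 != z.2) && (e z.1 z.2 || e z.2 z.1)].

Lemma edges_of_simple n e : is_simple (edges_of n e).
Proof.
apply/andP; split; apply/forallP => x; first by rewrite inE eqxx.
by apply/forallP => y; apply/eqP; rewrite !inE /= eq_sym orbC.
Qed.

Definition graph_of n (e : rel nat) : sgraph n :=
  exist _ (edges_of n e) (edges_of_simple n e).

Lemma adj_graph_of n e (x y : 'I_n) :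
  adj (graph_of n e) x y = (x != y) && (e x y || e y x).
Proof. by rewrite /adj inE. Qed.

Lemma eq_graph_of n (e e' : rel nat) :
  (forall x y, x < n -> y < n -> e x y = e' x y) -> graph_of n e = graph_of n e'.
Proof.
by move=> ee'; apply: val_inj; apply/setP => -[x y]; rewrite !inE /= !ee'.
Qed.

Lemma past_graph_of n e : past (graph_of n.+1 e) = graph_of n e.
Proof. by apply: val_inj; apply/setP => -[x y]; rewrite !inE. Qed.

(* A weak form of a perfect elimination ordering, with ties allowed in [k]. *)
Lemma chordal_elimination n (G : sgraph n) (k : 'I_n -> nat) :
  (forall v x y, adj G v x -> adj G v y -> k v <= k x -> k v <= k y -> x != y ->
     adj G x y) ->
  chordal G.
Proof.
move=> elim c /andP[cyc Uc] szc.
have [v0 v0c] : exists v, v \in c.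
  by case: c szc {cyc Uc} => // v c _; exists v; rewrite inE eqxx.
case: (arg_minnP k v0c) => v vc kmin.
have sym x y : adj G x y = adj G y x.
  by case/andP: (valP G) => _ /forallP/(_ x)/forallP/(_ y)/eqP.
have /rot_to[i c' rotc] := vc.
have eqn x : next (rot i c) x = next c x by apply: next_rot.
have eqp x : prev (rot i c) x = prev c x by apply: prev_rot.
have memr x : (x \in rot i c) = (x \in c) by rewrite mem_rot.
move: cyc Uc szc; rewrite -(rot_cycle i) -(rot_uniq i) -(size_rot i) rotc.
(* With the lowest vertex [v] rotated to the front, its successor [x] and predecessor [z] on the
   cycle span the chord. *)
case/lastP: c' rotc => // c' z; case: c' => // x c' rotc cyc Uc szc.
exists x, z; rewrite -eqn -eqp rotc.
have xc : x \in c by rewrite -memr rotc !inE eqxx orbT.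
have zc : z \in c by rewrite -memr rotc !(inE, mem_rcons) eqxx !orbT.
move: Uc cyc; rewrite /= rcons_path last_rcons !mem_rcons !inE !negb_or rcons_uniq.
rewrite mem_rcons inE negb_or.
move=> /andP[/and3P[vx vz vc'] /andP[/andP[xz xc'] /andP[zc' Uc']]].
case/and3P=> vx_adj _ zv_adj.
split=> //.
- by apply: (elim v) => //; rewrite ?kmin // sym.
- move: szc zc'; rewrite /next /= (eq_sym x v) (negbTE vx).
  case: c' {rotc xc' Uc' vc'} => //= u c' _; rewrite eqxx inE negb_or.
  by case/andP.
by rewrite /= eqxx eq_sym.
Qed.

Lemma chi_eq n (G : sgraph n) d (f : 'I_n -> 'I_d) (h : 'I_d -> 'I_n) :
  proper_coloring G f -> (forall i j, i != j -> adj G (h i) (h j)) -> chi G = d.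
Proof.
move=> fP hP; rewrite /chi; case: ex_minnP => m /existsP[c cP] mmin.
apply/eqP; rewrite eqn_leq mmin /=; last first.
  apply/existsP; exists [ffun x => f x].
  apply/forallP => x; apply/forallP => y; rewrite !ffunE.
  by move/forallP: fP => /(_ x)/forallP/(_ y).
have inj : injective (c \o h).
  move=> i j /= cij; apply/eqP/negPn/negP => /hP hij.
  by move/forallP: cP => /(_ (h i))/forallP/(_ (h j)); rewrite hij cij eqxx.
by have := leq_card _ inj; rewrite !card_ord.
Qed.

(* The blocks [k v] form a forest with parent map [p], whose roots are the
   fixed points of [p]; each block is completely joined to its parent. *)
Definition forest_rel (k p : nat -> nat) : rel nat :=
  fun x y => (k x == k y) || (p (k x) == k y).

(** As [B <= p B], a neighbor in a block of no smaller index lies in the same block or in its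
    parent, and these two together form a clique. *)
Lemma forest_chordal n k p : (forall B, B <= p B) ->
  chordal (graph_of n (forest_rel k p)).
Proof.
move=> pP; apply: (@chordal_elimination _ _ (fun v => k v)) => v x y.
have up w : adj (graph_of n (forest_rel k p)) v w -> k v <= k w ->
    k w = k v \/ k w = p (k v).
  rewrite adj_graph_of => /andP[_ vw] le.
  move: vw (pP (k w)); rewrite /forest_rel.
  by case/orP=> /orP[] /eqP; lia.
move=> /up{}up1 /up{}up2 /up1 kx /up2 ky xy.
rewrite adj_graph_of xy /= /forest_rel.
by case: kx => ->; case: ky => ->; rewrite eqxx ?orbT.
Qed.

Lemma forest_parity (p : nat -> nat) M :
  (forall B, (B <= p B) && ((p B < M) || (p B == B))) ->
  exists par : nat -> bool, forall B, p B != B -> par B != par (p B).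
Proof.
move=> pP.
suff ex : forall m, exists par : nat -> bool,
    forall B, M - m <= B -> p B != B -> par B != par (p B).
  by have [par parP] := ex M; exists par => B; apply: parP; rewrite subnn.
elim=> [|m [par parP]].
  exists xpredT => B; rewrite subn0 => MB.
  by move: (pP B) => /andP[? /orP[]]; [lia|move=> ->].
(* At most the index [M - m.+1] is gained; its parent has a larger index, where [par] is kept. *)
exists (fun B => if M - m <= B then par B else ~~ par (p B)) => B mB pB.
have /andP[BpB _] := pP B.
have BltpB : B < p B by rewrite ltn_neqAle eq_sym pB.
have -> : M - m <= p B by lia.
by case: ifP => [le|_]; [apply: parP|case: (par _)].
Qed.

(** * Partial colorings of a growing graph *)

Section Adversary.

Variables (b : nat) (A : online_alg b).

(** Vertices are plain naturals, with [None] also for those not yet presented, so that different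
    times compare without casts. *)
Definition color (e : rel nat) t v : option nat :=
  obind (run A (graph_of t e)) (insub v).

Lemma color_ord e t (i : 'I_t) : color e t i = run A (graph_of t e) i.
Proof. by rewrite /color valK. Qed.

Lemma color_lt e t v c : color e t v = Some c -> v < t.
Proof. by rewrite /color; case: insubP. Qed.

(** Only the part of the relation revealed by time [t] matters, so the adversary may choose the rest
    afterwards. *)
Lemma color_mono e e' t t' v c :
  (forall x y, x < t -> y < t -> e x y = e' x y) -> t <= t' ->
  color e t v = Some c -> color e' t' v = Some c.
Proof.
move=> /eq_graph_of ee' tt'.
have -> : color e t v = color e' t v by rewrite /color ee'.
move: tt' => /subnK <-; elim: (t' - t) => // m IHm /IHm{IHm} H.
have lt := color_lt H; rewrite addSn.
have -> : v = widen_ord (leqnSn (m + t)) (Ordinal lt) by [].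
rewrite color_ord; apply: run_irrevocable.
by rewrite past_graph_of -color_ord.
Qed.

Lemma color_proper e t x y c :
  x != y -> e x y || e y x -> color e t x = Some c -> color e t y <> Some c.
Proof.
move=> xy exy Hx Hy; move: (color_lt Hx) (color_lt Hy) => ltx lty.
move: Hx Hy; rewrite (color_ord e (Ordinal ltx)) (color_ord e (Ordinal lty)).
by apply: run_proper; rewrite adj_graph_of -val_eqE /= xy.
Qed.

Lemma uncolored_le e t : count (fun v => ~~ color e t v) (iota 0 t) <= b.
Proof.
rewrite -val_enum_ord count_map.
rewrite (eq_count (a2 := predC (fun i => run A (graph_of t e) i))); last first.
  by move=> i /=; rewrite color_ord.
have := run_buffer A (graph_of t e).
rewrite cardsE cardE {1}/enum_mem size_filter -enumT.
have := count_predC (fun i : 'I_t => run A (graph_of t e) i : bool) (enum 'I_t).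
rewrite size_enum_ord; set x := count _ _; set y := count _ _; lia.
Qed.

Variable q : nat.
Hypothesis q_gt0 : 0 < q.

(** [r] colored vertices of one block settle a family, [g] is the gain per round, and [s] bounds the
    families that the buffer can spoil: each takes at least [q - r + 1] buffered vertices. *)
Let r := uphalf q.
Let g := uphalf r.
Let s := b %/ (q - r).+1.

(** * Blocks, their colors, and candidates under extension of the forest *)

Definition block B := iota (B * q) q.
Definition block_rel (p : nat -> nat) : rel nat := forest_rel (fun v => v %/ q) p.
Definition vertices (S : seq nat) := flatten (map block S).
Definition colors M p S :=
  undup (pmap (color (block_rel p) (M * q)) (vertices S)).

Lemma mem_block B v : (v \in block B) = (v %/ q == B).
Proof.
rewrite mem_iota eqn_leq leq_divRL // -(ltnS (v %/ q)) ltn_divLR //.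
by rewrite mulSn andbC addnC.
Qed.

Lemma mem_vertices S v : (v \in vertices S) = (v %/ q \in S).
Proof.
apply/flatten_mapP/idP => [[B BS]|vS]; first by rewrite mem_block => /eqP ->.
by exists (v %/ q); rewrite // mem_block.
Qed.

Lemma uniq_vertices S : uniq S -> uniq (vertices S).
Proof.
elim: S => //= B S IHS /andP[BS /IHS US].
rewrite /vertices /= cat_uniq iota_uniq /= US andbT.
apply/hasPn => v; rewrite -/(vertices S) mem_vertices mem_block => vS.
by apply: contraNneq BS => <-.
Qed.

Lemma mem_colors M p S c :
  reflect (exists2 v, v %/ q \in S & color (block_rel p) (M * q) v = Some c)
          (c \in colors M p S).
Proof.
rewrite mem_undup mem_pmap; apply: (iffP mapP) => -[v].
  by rewrite mem_vertices; exists v.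
by exists v; rewrite ?mem_vertices.
Qed.

(** The condition [B != Q] exempts loops: a root below [M] may later receive a parent among the
    blocks from [M] on. *)
Definition extends M p M' p' :=
  M <= M' /\ forall B Q, B < M -> Q < M -> B != Q -> (p B == Q) = (p' B == Q).

Lemma extends_refl M p : extends M p M p.
Proof. by []. Qed.

Lemma extends_trans M1 p1 M2 p2 M3 p3 :
  extends M1 p1 M2 p2 -> extends M2 p2 M3 p3 -> extends M1 p1 M3 p3.
Proof.
move=> [le12 eq12] [le23 eq23]; split; first exact: leq_trans le23.
by move=> B Q BM QM BQ; rewrite eq12 // eq23 //; apply: leq_trans le12.
Qed.

Lemma color_extends M p M' p' v c : extends M p M' p' ->
  color (block_rel p) (M * q) v = Some c ->
  color (block_rel p') (M' * q) v = Some c.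
Proof.
move=> [MM' pp']; apply: color_mono; last by rewrite leq_mul2r MM' orbT.
move=> x y xM yM; rewrite /block_rel /forest_rel; have [//|xy] := eqVneq (x %/ q).
by rewrite pp' // ltn_divLR.
Qed.

Lemma colors_extends M p M' p' S : extends M p M' p' ->
  {subset colors M p S <= colors M' p' S}.
Proof.
move=> ext c /mem_colors[v vS cv]; apply/mem_colors; exists v => //.
exact: color_extends cv.
Qed.

Definition colored M p B := count (color (block_rel p) (M * q)) (block B).

(** A block is a clique, so its colored vertices have distinct colors. *)
Lemma size_colors_block M p B : size (colors M p [:: B]) = colored M p B.
Proof.
rewrite /colors undup_id ?size_pmap /vertices /= cats0 //.
have := iota_uniq (B * q) q; rewrite -/(block B).
have : {subset block B <= block B} by [].
elim: {1 3 4}(block B) => //= v vs IHvs sub /andP[vvs Uvs].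
have {}IHvs: uniq (pmap (color (block_rel p) (M * q)) vs).
  by apply: IHvs => // w ws; apply: sub; rewrite inE ws orbT.
case cv: (color _ _ v) => [c|] //=; rewrite IHvs andbT mem_pmap.
apply/mapP => -[w ws /esym cw]; apply: color_proper cv cw; last first.
  rewrite /block_rel /forest_rel.
  have := sub v (mem_head _ _); rewrite mem_block => /eqP ->.
  have : w \in v :: vs by rewrite inE ws orbT.
  by move=> /sub; rewrite mem_block => /eqP ->; rewrite eqxx.
by apply: contraNneq vvs => ->.
Qed.

Definition good M p k S := k * g <= size (colors M p S).

(** All later states are quantified over, since the buffer is inspected only after a whole round of
    pairings. *)
Definition candidate M p k S := exists2 B, B \in S &
  forall M' p', extends M p M' p' -> r <= colored M' p' B -> good M' p' k S.

Lemma good_extends M p M' p' k S : extends M p M' p' ->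
  good M p k S -> good M' p' k S.
Proof.
move=> ext /leq_trans; apply; apply: uniq_leq_size (undup_uniq _) _.
exact: colors_extends.
Qed.

Lemma candidate_extends M p M' p' k S : extends M p M' p' ->
  candidate M p k S -> candidate M' p' k S.
Proof.
move=> ext [B BS cand]; exists B => // M2 p2 ext2; apply: cand.
exact: extends_trans ext2.
Qed.

(* A candidate is bad only if more than [q - r] vertices of one of its blocks are
   in the buffer, and the blocks of different candidates are disjoint. *)
Lemma most_candidates_good M p k (Ss : seq (seq nat)) :
  (forall S, S \in Ss -> candidate M p k S) ->
  uniq (flatten Ss) -> all (fun B => B < M) (flatten Ss) ->
  size Ss <= size [seq S <- Ss | good M p k S] + s.
Proof.
move=> cand Uf lt; rewrite -(count_predC (good M p k) Ss) size_filter leq_add2l.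
rewrite /s leq_divRL // -size_filter; set bad := seq.filter _ _.
pose unc := count (fun v => ~~ color (block_rel p) (M * q) v).
have subf : subseq (flatten bad) (flatten Ss).
  rewrite /bad; elim: (Ss) => //= S Ss' IH; case: ifP => _ /=.
    by apply: cat_subseq.
  exact: subseq_trans IH (suffix_subseq _ _).
have Ub : uniq (flatten bad) := subseq_uniq subf Uf.
apply: leq_trans (uncolored_le (block_rel p) (M * q)).
apply: (@leq_trans (unc (vertices (flatten bad)))).
  have : forall S, S \in bad -> q - r < unc (vertices S).
    move=> S; rewrite mem_filter /= => /andP[nok /cand[B BS candB]].
    have ltr : colored M p B < r.
      by rewrite ltnNge; apply: contraNN nok; apply: candB; apply: extends_refl.
    have : unc (block B) <= unc (vertices S).
      rewrite /unc -!size_filter; apply: uniq_leq_size.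
        exact/filter_uniq/iota_uniq.
      by move=> v; rewrite !mem_filter mem_vertices mem_block => /andP[-> /eqP ->].
    have := count_predC (color (block_rel p) (M * q)) (block B).
    rewrite -[count (color _ _) _]/(colored M p B) -[count (predC _) _]/(unc _).
    rewrite size_iota; have : r <= q by rewrite /r; lia.
    lia.
  elim: (bad) => //= S Ss' IH H.
  rewrite /vertices map_cat flatten_cat /unc count_cat mulSn leq_add //.
    by apply: H; rewrite mem_head.
  by apply: IH => T TS; apply: H; rewrite inE TS orbT.
rewrite /unc -!size_filter; apply: uniq_leq_size.
  exact/filter_uniq/uniq_vertices.
move=> v; rewrite !mem_filter mem_vertices => /andP[-> /(mem_subseq subf)].
by move/(allP lt); rewrite mem_iota /= ltn_divLR.
Qed.

Definition forest M (p : nat -> nat) :=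
  forall B, (B <= p B) && ((p B < M) || (p B == B)).

Definition roots M p (S : seq nat) := all (fun B => (B < M) && (p B == B)) S.

Lemma r_gt0 : 0 < r. Proof. by rewrite /r uphalf_gt0. Qed.
Lemma g_gt0 : 0 < g. Proof. by rewrite /g uphalf_gt0 r_gt0. Qed.

(** If the union does not show [k.+1 * g] colors, block [M] becomes the parent of [S2] and joins
    [S1]. Colors of [M] seen in [S1] are absent from [S2], so they add to those of [S2] inside the
    union and are fewer than [g]; [r] colors of [M] thus include at least [r - g + 1 >= g] new
    ones. *)
Lemma combine M p k S1 S2 : forest M p ->
  good M p k S1 -> good M p k S2 -> uniq (S1 ++ S2) -> roots M p (S1 ++ S2) ->
  exists M' p' S,
    [/\ forest M' p', extends M p M' p', M' <= M.+1 &
        forall B, B < M -> B \notin S1 ++ S2 -> p' B = p B] /\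
    [/\ candidate M' p' k.+1 S, uniq S, roots M' p' S &
        forall B, B \in S -> (B \in S1 ++ S2) || (M <= B)].
Proof.
move=> fp good1 good2 U rts.
have [gd|ngd] := boolP (good M p k.+1 (S1 ++ S2)).
  exists M, p, (S1 ++ S2); split; split=> //; last by move=> B ->.
  have [B BS] : exists B, B \in S1 ++ S2.
    case: (S1 ++ S2) gd => [|B S _]; last by exists B; rewrite mem_head.
    by rewrite /good /colors /= leqn0 muln_eq0 /= eqn0Ngt g_gt0.
  by exists B => // M' p' ext _; apply: good_extends gd.
pose p' B := if B \in S2 then M else p B.
have ltM B : B \in S1 ++ S2 -> B < M by move/(allP rts)/andP=> [].
have pS B : B \in S1 ++ S2 -> p B = B by move/(allP rts)/andP=> [_ /eqP].
have MS B : B \in S1 ++ S2 -> B != M by move/ltM; rewrite ltn_neqAle => /andP[].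
have MnS : M \notin S1 ++ S2 by apply/negP => /MS; rewrite eqxx.
have [MnS1 MnS2] : M \notin S1 /\ M \notin S2.
  by move: MnS; rewrite mem_cat negb_or => /andP.
have pM : p M = M by move: (fp M) => /andP[le /orP[lt|/eqP//]]; lia.
have ext : extends M p M.+1 p'.
  split=> // B Q BM QM BQ; rewrite /p'; case: ifP => // BS2.
  by rewrite pS ?mem_cat ?BS2 ?orbT //; move/negbTE: BQ => ->; lia.
move: (U); rewrite cat_uniq => /and3P[U1 /hasPn dis U2].
exists M.+1, p', (M :: S1); split; split=> //.
- move=> B; rewrite /p'; case: ifP => BS2.
    by rewrite ltnSn andbT ltnW // ltM // mem_cat BS2 orbT.
  move: (fp B) => /andP[-> /orP[lt|->]]; last by rewrite orbT.
  by rewrite ltnS ltnW.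
- by move=> B _; rewrite mem_cat negb_or /p' => /andP[_ /negbTE ->].
- exists M; first by rewrite mem_head.
  move=> M2 p2 ext2; rewrite -size_colors_block => rM.
  have ext02 := extends_trans ext ext2.
  set C1 := colors M p S1; set C2 := colors M p S2.
  set CM := colors M2 p2 [:: M] in rM.
  have disj c : c \in CM -> c \notin C2.
    move=> /mem_colors[v]; rewrite inE => /eqP vM cv.
    apply/negP => /(colors_extends ext02)/mem_colors[w wS cw].
    apply: color_proper cv cw.
      by apply: contraNneq MnS2 => vw; rewrite -vM vw.
    have [_ ee] := ext2.
    have wM : w %/ q < M by rewrite ltM // mem_cat wS orbT.
    apply/orP; right; rewrite /block_rel /forest_rel vM -ee //; last 2 first.
    - exact: ltnW.
    - by rewrite neq_ltn wM.
    by rewrite /p' wS eqxx orbT.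
  pose new := [seq c <- CM | c \notin C1].
  pose old := [seq c <- CM | c \in C1].
  have UC1 : uniq C1 := undup_uniq _.
  have UC2 : uniq C2 := undup_uniq _.
  have UCM : uniq CM := undup_uniq _.
  have sz : size old + size new = size CM by rewrite !size_filter count_predC.
  have le_new : size C1 + size new <= size (colors M2 p2 (M :: S1)).
    rewrite -size_cat; apply: uniq_leq_size.
      rewrite cat_uniq UC1 filter_uniq // andbT /=.
      by apply/hasPn => c; rewrite mem_filter => /andP[].
    move=> c; rewrite mem_cat mem_filter => /orP[|/andP[_]].
      move/(colors_extends ext02)/mem_colors => [v vS cv].
      by apply/mem_colors; exists v; rewrite // inE vS orbT.
    move/mem_colors => [v]; rewrite inE => /eqP vM cv.
    by apply/mem_colors; exists v; rewrite // inE vM eqxx.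
  have le_old : size C2 + size old <= size (colors M p (S1 ++ S2)).
    rewrite -size_cat; apply: uniq_leq_size.
      rewrite cat_uniq UC2 filter_uniq // andbT /=.
      by apply/hasPn => c; rewrite mem_filter => /andP[_ /disj].
    move=> c; rewrite mem_cat mem_filter => /orP[|/andP[+ _]].
      move=> /mem_colors[v vS cv].
      by apply/mem_colors; exists v; rewrite // mem_cat vS orbT.
    move=> /mem_colors[v vS cv].
    by apply/mem_colors; exists v; rewrite // mem_cat vS.
  move: ngd good1 good2; rewrite /good -/C1 -/C2 -ltnNge mulSn.
  have : g.*2 <= r.+1 by rewrite /g; lia.
  lia.
- by rewrite /= MnS1.
- rewrite /roots /= ltnSn /p' (negbTE MnS2) pM eqxx /=.
  apply/allP => B BS1; have BS : B \in S1 ++ S2 by rewrite mem_cat BS1.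
  rewrite ltnS ltnW ?ltM //=; case: ifP => [/dis|_]; first by rewrite BS1.
  by rewrite pS.
move=> B; rewrite inE mem_cat => /orP[/eqP ->|->//].
by rewrite leqnn orbT.
Qed.

Lemma combine_pairs n : forall M p k (todo done : seq (seq nat)),
  n.*2 <= size todo -> forest M p ->
  (forall S, S \in todo -> good M p k S) ->
  (forall S, S \in done -> candidate M p k.+1 S) ->
  uniq (flatten (todo ++ done)) -> roots M p (flatten (todo ++ done)) ->
  exists M' p' Ss,
    [/\ forest M' p', extends M p M' p' & M' <= M + n] /\
    [/\ size Ss = n + size done, forall S, S \in Ss -> candidate M' p' k.+1 S,
        uniq (flatten Ss) & roots M' p' (flatten Ss)].
Proof.
elim: n => [|n IHn] M p k todo done.
  move=> _ fp _ cand; rewrite flatten_cat cat_uniq /roots all_cat.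
  move=> /and3P[_ _ U] /andP[_ rts].
  by exists M, p, done; split; split; rewrite ?addn0.
case: todo => [|S1 [|S2 todo]] //; rewrite doubleS !ltnS => szt fp gd cand.
set rest := flatten (todo ++ done).
rewrite /= catA cat_uniq /roots all_cat => /and3P[U /hasPn dis Ur] /andP[rts rtsr].
have [||//|//|M1 [p1 [S [[fp1 ext1 leM1 same] [candS US rtsS subS]]]]] :=
    @combine M p k S1 S2 fp.
- by apply: gd; rewrite mem_head.
- by apply: gd; rewrite !inE eqxx orbT.
have [MM1 _] := ext1.
have rest_lt B : B \in rest -> B < M by move/(allP rtsr)/andP=> [].
have perm : perm_eq (flatten (todo ++ S :: done)) (S ++ rest).
  by rewrite /rest !flatten_cat /= perm_catCA.
have [//|//|||||M2 [p2 [Ss [[fp2 ext2 leM2] [sz2 cand2 U2 rts2]]]]] :=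
    IHn M1 p1 k todo (S :: done).
- move=> T Tt; apply: good_extends ext1 _; apply: gd.
  by rewrite !inE Tt !orbT.
- move=> T; rewrite inE => /orP[/eqP -> //|/cand]; exact: candidate_extends.
- rewrite (perm_uniq perm) cat_uniq US Ur andbT /=.
  apply/hasPn => B Br; apply/negP => /subS /orP[]; first exact/negP/dis.
  by rewrite leqNgt rest_lt.
- rewrite /roots (perm_all _ perm) all_cat -!/(roots _ _ _) rtsS /=.
  apply/allP => B Br; rewrite same ?rest_lt //; last exact: dis.
  move/(allP rtsr): (Br) => /andP[lt ->]; rewrite andbT.
  exact: leq_trans MM1.
exists M2, p2, Ss; split; split=> //.
- exact: extends_trans ext2.
- by apply: leq_trans leM2 _; rewrite addnS -addSn leq_add2r.
- by rewrite sz2 /= addnS.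
Qed.

(** A round turns [N] families into at least [(N - s - 1) / 2], so it at most halves [N + s + 1]. At
    the end [s + 1] families remain, one of them unspoiled. New blocks number at most
    [N/2 + N/4 + ... <= N]. *)
Lemma force_colors K : forall M p k (Ss : seq (seq nat)),
  2 ^ K * (s + s).+2 <= size Ss + s.+1 -> forest M p ->
  (forall S, S \in Ss -> candidate M p k S) ->
  uniq (flatten Ss) -> roots M p (flatten Ss) ->
  exists M' p' S,
    [/\ forest M' p', M' <= M + size Ss & good M' p' (k + K) S].
Proof.
elim: K => [|K IHK] M p k Ss szs fp cand U rts.
all: have ltf : all (fun B => B < M) (flatten Ss)
  by apply: sub_all rts => B /andP[].
all: have := most_candidates_good cand U ltf.
all: set Gs := seq.filter _ _ => szG.
  exists M, p, (nth [::] Gs 0); split; rewrite ?leq_addr //.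
  have : nth [::] Gs 0 \in Gs.
    rewrite mem_nth //; move: szs szG; rewrite expn0.
    by move: (size Gs) (size Ss) (s) => x y z; lia.
  by rewrite mem_filter addn0 => /andP[].
have subf : subseq (flatten Gs) (flatten Ss).
  rewrite /Gs; elim: (Ss) => //= S Ss' IH; case: ifP => _ /=.
    by apply: cat_subseq.
  exact: subseq_trans IH (suffix_subseq _ _).
have [|//||//|||M1 [p1 [Ss1 [[fp1 ext1 leM1] [sz1 cand1 U1 rts1]]]]] :=
    @combine_pairs (size Gs)./2 M p k Gs [::].
- lia.
- by move=> S; rewrite mem_filter => /andP[].
- by rewrite cats0 (subseq_uniq subf).
- rewrite cats0; apply/allP => B /(mem_subseq subf); exact: (allP rts).
have szG' : size Gs <= size Ss by rewrite size_filter count_size.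
have [|//|//|//|//|M2 [p2 [S [fp2 leM2 gd2]]]] := IHK M1 p1 k.+1 Ss1.
  by move: szs; rewrite expnS sz1 /=; lia.
exists M2, p2, S; split=> //; last by rewrite addnS -addSn.
by move: sz1 => /=; lia.
Qed.

(** The start is [N] unjoined blocks, candidates for [k = 1] because [r] colored vertices of a
    clique show [r >= g] colors. *)
Lemma force_colors_start K N : 2 ^ K * (s + s).+2 <= N + s.+1 ->
  exists M p S, [/\ forest M p, M <= N.*2 & good M p K.+1 S].
Proof.
move=> le.
have flat : flatten [seq [:: B] | B <- iota 0 N] = iota 0 N.
  by elim: (iota 0 N) => //= B l ->.
have [|||||M [p [S [fp leM gd]]]] :=
  @force_colors K N id 1 [seq [:: B] | B <- iota 0 N].
- by rewrite size_map size_iota.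
- by move=> B; rewrite leqnn eqxx orbT.
- move=> _ /mapP[B _ ->]; exists B; first by rewrite mem_head.
  move=> M' p' _; rewrite /good size_colors_block mul1n; apply: leq_trans.
  by rewrite /g; lia.
- by rewrite flat iota_uniq.
- by rewrite flat; apply/allP => B; rewrite mem_iota eqxx andbT.
exists M, p, S; split=> //.
by move: leM; rewrite size_map size_iota addnn.
Qed.

End Adversary.

(** * Assembling the graph on [n] vertices *)

(* The forest of blocks is followed by one clique on [d] vertices, which forms
   block [M], and by isolated vertices. *)
Lemma adversary_wins b (A : online_alg b) d n K :
  let q := d./2 in let r := uphalf q in let s := b %/ (q - r).+1 in
  1 < d -> d <= n -> 2 ^ K * (s + s).+2 <= n %/ d + s ->
  exists G : sgraph n,
    [/\ chordal G, chi G = d & K.+1 * uphalf r <= colors_used A G].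
Proof.
move=> q r s d_gt1 dn le.
have q_gt0 : 0 < q by rewrite /q; lia.
have nd_gt0 : 0 < n %/ d by rewrite divn_gt0; lia.
(* The predecessor keeps [d] vertices free for the final clique: with [N = n %/ d - 1], at most
   [2 N] blocks of [q <= d / 2] vertices take at most [N d]. *)
have [|M [p [S [fp leM gd]]]] := @force_colors_start b A q q_gt0 K (n %/ d).-1.
  by rewrite -addSnnS prednK.
pose T := M * q.
have Tdn : T + d <= n.
  apply: leq_trans (leq_divM n d).
  rewrite -{1}(prednK nd_gt0) mulSn addnC leq_add2l.
  apply: (@leq_trans ((n %/ d).-1.*2 * q)); first by rewrite leq_mul2r leM orbT.
  by rewrite -doubleMl doubleMr leq_mul2l /q; lia.
have MT : M <= T by rewrite leq_pmulr.
(* An isolated vertex is its own block, with index at least [T >= M], hence a root. *)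
pose k v := if v < T then v %/ q else if v < T + d then M else v.
pose pos v := if v < T then v %% q else if v < T + d then v - T else 0.
have lep B : B <= p B by move: (fp B) => /andP[].
have kltM v : v < T -> k v < M by move=> vT; rewrite /k vT ltn_divLR.
have kgeM v : T <= v -> M <= k v.
  by move=> vT; rewrite /k ltnNge vT /=; case: ifP => // _; exact: leq_trans vT.
have plt B : B < M -> p B < M.
  by move=> BM; move: (fp B) => /andP[_ /orP[//|/eqP->]].
have pge B : M <= B -> p B = B.
  by move=> MB; move: (fp B) => /andP[le' /orP[lt|/eqP//]]; lia.
have [par parP] := forest_parity fp.
have kT v : (v < T) = (k v < M).
  by case: (ltnP v T) => vT; [rewrite kltM|rewrite ltnNge kgeM].
have kpos v w : k v = k w -> pos v = pos w -> v = w.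
  move=> kk; have : (v < T) = (w < T) by rewrite !kT kk.
  move: kk; rewrite /k /pos.
  case: (ltnP v T) => vT; case: (ltnP w T) => wT // kk _ pp.
    by rewrite (divn_eq v q) kk pp -divn_eq.
  by move: kk pp; case: ifP; case: ifP; lia.
pose G := graph_of n (forest_rel k p).
(* Depth parity selects one of two palettes of [q] colors in the forest; the clique takes all colors
   below [d], isolated vertices take 0. *)
pose col v := (if (v < T) && par (k v) then q else 0) + pos v.
have col_lt v : col v < d.
  rewrite /col /pos; case: (ltnP v T) => vT /=; last by case: ifP; lia.
  have : v %% q < q by rewrite ltn_mod.
  by case: (par _); rewrite /q; lia.
have col_block x y : x <> y -> k x = k y -> col x <> col y.
  move=> xy kk; rewrite /col !kT kk => /eqP; rewrite eqn_add2l => /eqP pp.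
  by apply: xy; apply: kpos.
have col_proper x y : x <> y -> forest_rel k p x y -> col x <> col y.
  move=> xy /orP[/eqP|/eqP pk]; first exact: col_block.
  have [kk|npk] := eqVneq (p (k x)) (k x); first by apply: col_block; rewrite // -pk.
  have kxM : k x < M.
    by rewrite ltnNge; apply: contraNN npk => /pge ->.
  have := parP _ npk; rewrite pk /col /pos !kT kxM -pk plt //.
  have : x %% q < q by rewrite ltn_mod.
  have : y %% q < q by rewrite ltn_mod.
  by rewrite pk; case: (par _); case: (par _) => //=; lia.
exists G; split; first exact: forest_chordal.
  have hlt (i : 'I_d) : T + i < n by have := ltn_ord i; lia.
  apply: (@chi_eq _ _ _ (fun v => Ordinal (col_lt v)) (fun i => Ordinal (hlt i))).
    apply/forallP => x; apply/forallP => y; apply/implyP.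
    rewrite adj_graph_of -!val_eqE /= => /andP[/eqP xy] /orP[]/col_proper H.
      by apply/eqP/H.
    by rewrite eq_sym; apply/eqP/H => /esym.
  move=> i j; rewrite adj_graph_of -!val_eqE /= eqn_add2l => -> /=.
  have kM (l : 'I_d) : k (T + l) = M.
    by rewrite /k ltnNge leq_addr ltn_add2l ltn_ord.
  by rewrite /forest_rel !kM eqxx.
apply: leq_trans gd _; apply: uniq_leq_size (undup_uniq _) _ => c.
case/(mem_colors A q_gt0) => v _ cv; rewrite mem_undup.
have cv' : color A (forest_rel k p) n v = Some c.
  apply: color_mono cv; last by apply: leq_trans Tdn; apply: leq_addr.
  by move=> x y xT yT; rewrite /block_rel /forest_rel /k xT yT.
have vn := color_lt cv'.
apply/codomP; exists (Ordinal vn); apply/esym/final_irrevocable.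
by rewrite -color_ord.
Qed.

(** Roundings are absorbed by [s d <= 4 b] and [d <= 12 g], with [g] the gain per round; each of the
    two size hypotheses pays for half of [n]. *)
Lemma adversary_wins_simple b (A : online_alg b) d n K :
  1 < d -> 2 ^ K * b * 16 <= n -> 2 ^ K * d * 4 <= n ->
  exists G : sgraph n,
    [/\ chordal G, chi G = d & K.+1 * d <= colors_used A G * 12].
Proof.
move=> d_gt1 leb led.
have K_gt0 : 0 < 2 ^ K by rewrite expn_gt0.
have [| |G [Gc Gd Gk]] := @adversary_wins b A d n K d_gt1.
- by apply: leq_trans led; rewrite -mulnA -[leqLHS]mul1n leq_mul //; lia.
- set h := d./2 - uphalf d./2; set s := b %/ h.+1.
  apply: leq_trans (leq_addr _ _); rewrite leq_divRL; last lia.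
  have sb : s * d <= b * 4.
    apply: (@leq_trans (s * (h.+1 * 4))); first by rewrite leq_mul2l /h; lia.
    by rewrite mulnA leq_mul2r leq_divM orbT.
  have : 2 ^ K * (s * d) <= 2 ^ K * (b * 4) by rewrite leq_mul2l sb orbT.
  nia.
exists G; split=> //.
apply: (@leq_trans (K.+1 * (uphalf (uphalf d./2) * 12))).
  by rewrite leq_mul2l; lia.
by rewrite mulnA leq_mul2r Gk orbT.
Qed.

(** * Real estimates and the choice of the number of rounds *)

Import Order.TTheory GRing.Theory Num.Theory.
Local Open Scope ring_scope.

(** Applied with [y = n^(eps/7)], [z = n^(1-eps)] and [x = 2^K]. The first bound uses [16 <= y^6];
    the second is squared: [(4 x d)^2 = 8 x^2 (2 d^2) <= 8 y^2 n <= y^7 n <= n^2]. *)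
Lemma power_bounds (R : realFieldType) (n y z x b d : R) :
  2 <= y -> y ^+ 7 * z = n -> y ^+ 7 <= n -> 0 <= x <= y -> 0 <= b <= z ->
  0 <= d -> 2 * d ^+ 2 <= n -> x * b * 16 <= n /\ x * d * 4 <= n.
Proof.
move=> y_ge2 y7n y7le /andP[x_ge0 xy] /andP[b_ge0 bz] d_ge0 dn.
have y_ge0 : 0 <= y by lra.
have y2_ge0 : 0 <= y ^+ 2 by rewrite exprn_ge0.
have y5 : 2 ^+ 5 <= y ^+ 5 by rewrite lerXn2r ?nnegrE.
have y6 : 2 ^+ 6 <= y ^+ 6 by rewrite lerXn2r ?nnegrE.
have z_ge0 : 0 <= z by apply: le_trans bz.
split.
  rewrite -y7n (_ : y ^+ 7 * z = y * z * y ^+ 6); last by ring.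
  apply: ler_pM; rewrite ?mulr_ge0 ?ler_pM //.
  by apply: le_trans y6; lra.
have n_ge0 : 0 <= n by apply: le_trans y7le; rewrite exprn_ge0.
rewrite -(@ler_pXn2r _ 2) ?nnegrE ?mulr_ge0 //.
apply: (@le_trans _ _ (y ^+ 2 * 8 * (2 * d ^+ 2))).
  rewrite (_ : (x * d * 4) ^+ 2 = x ^+ 2 * 8 * (2 * d ^+ 2)); last by ring.
  by rewrite !ler_wpM2r ?mulr_ge0 ?exprn_ge0 // lerXn2r ?nnegrE.
rewrite (_ : n ^+ 2 = n * n) //; apply: ler_pM; rewrite ?mulr_ge0 ?exprn_ge0 //.
apply: le_trans y7le; rewrite (_ : y ^+ 7 = y ^+ 2 * y ^+ 5); last by ring.
by rewrite ler_wpM2l //; lra.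
Qed.

Theorem theorem5 (R : realType) :
  exists C : R, 0 < C /\
  forall (d : nat) (eps : R), (2 <= d)%N -> 0 < eps <= 1 ->
  forall (b : nat) (A : online_alg b) (n : nat),
  b%:R <= n%:R `^ (1 - eps) ->
  Num.max (2 * d%:R ^+ 2) (2 `^ (7 / eps)) <= n%:R :> R ->
  exists G : sgraph n,
    [/\ chordal G, chi G = d &
        C * (eps * d%:R * log2 n%:R) <= (colors_used A G)%:R].
Proof.
(* [84 = 7 * 12]: 12 is the loss in [adversary_wins_simple], 7 comes from
   [eps * log n = 7 * log y]. *)
exists (84%:R^-1); split; first by rewrite invr_gt0.
move=> d eps d_ge2 /andP[eps_gt0 eps_le1] b A n bn.
rewrite ge_max => /andP[dn en].
have d_gt0 : 0 < d%:R :> R by rewrite ltr0n; lia.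
have n_ge1 : 1 <= n%:R :> R.
  apply: le_trans dn; have : 1 <= d%:R :> R by rewrite ler1n; lia.
  nra.
have n_gt0 : 0 < n%:R :> R by lra.
have eps7 : 7 / eps * (eps / 7) = 1 by field; rewrite gt_eqF.
have [y [y_ge2 y7 logy]] : exists y : R,
    [/\ 2 <= y, y ^+ 7 = n%:R `^ eps & eps * log2 n%:R = 7 * log2 y].
  (* With this choice the hypothesis [2^(7/eps) <= n] becomes [2 <= y]. *)
  exists (n%:R `^ (eps / 7)); split.
  - have e2 : (2 `^ (7 / eps)) `^ (eps / 7) = 2 :> R by rewrite -powRrM eps7 powRr1.
    rewrite -[leLHS]e2.
    by apply: ge0_ler_powR; rewrite ?nnegrE ?powR_ge0 //; lra.
  - by rewrite -powR_mulrn ?powR_ge0 // -powRrM; congr (_ `^ _); field.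
  rewrite /log2 ln_powR; field.
  by rewrite gt_eqF // ln_gt0 // ltr1n.
have y7n : y ^+ 7 * n%:R `^ (1 - eps) = n%:R.
  rewrite y7 -powRD; last by apply/implyP => _; rewrite gt_eqF.
  by rewrite (addrC eps) subrK powRr1 // ltW.
have y7le : y ^+ 7 <= n%:R.
  by rewrite y7 -[leRHS]powRr1 ?ler_powR // ltW.
(* [K] is the floor of [log2 y], so [2^K <= y < 2^(K+1)]. *)
pose K := trunc_log 2 (Num.truncn y).
have y_ge0 : 0 <= y by lra.
have tr_gt0 : (0 < Num.truncn y)%N by rewrite truncn_gt0; lra.
have K_le : 2 ^+ K <= y.
  have : (Num.truncn y)%:R <= y by rewrite truncn_le.
  by rewrite -natrX; apply: le_trans; rewrite ler_nat; apply: trunc_logP.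
have K_gt : y < 2 ^+ K.+1.
  rewrite -natrX; apply: lt_le_trans (truncnS_gt y) _; rewrite ler_nat.
  exact: trunc_log_ltn.
have [G [Gc Gd Gk]] : exists G : sgraph n,
    [/\ chordal G, chi G = d & (K.+1 * d <= colors_used A G * 12)%N].
  have xy : 0 <= (2 ^+ K : R) <= y by rewrite exprn_ge0.
  have bz : 0 <= (b%:R : R) <= n%:R `^ (1 - eps) by rewrite ler0n.
  have [leb led] := power_bounds y_ge2 y7n y7le xy bz (ltW d_gt0) dn.
  by apply: adversary_wins_simple; rewrite // -(ler_nat R) !natrM natrX.
exists G; split=> //.
have logK : log2 y <= K.+1%:R.
  rewrite /log2 ler_pdivrMr ?ln_gt0 ?ltr1n // mulr_natl -lnXn //.
  by rewrite ler_ln ?posrE ?exprn_gt0 //; [exact: ltW|lra].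
rewrite (_ : eps * d%:R * log2 n%:R = 7 * d%:R * log2 y); last first.
  by rewrite mulrAC logy; ring.
move: Gk; rewrite -(ler_nat R) !natrM => Gk.
have : log2 y * d%:R <= K.+1%:R * d%:R by rewrite ler_pM2r.
lra.
Qed.
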